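(* Let $\mathscr{F}\subseteq\mathscr{P}(\omega)$ be an $\omega$-closed family with $\varnothing\in\mathscr{F}$. Then the semigroup $\boldsymbol{B}_{\mathbb{Z}}^{\mathscr{F}}$ is $0$-simple if and only if for all nonempty sets $F_1,F_2\in\mathscr{F}$ there exist $k_1,k_2\in\omega$ such that $F_1\subseteq -k_1+F_2$ and $F_2\subseteq -k_2+F_1$.
   Context: $\omega$ is the set of non-negative integers and $\mathscr{P}(\omega)$ is the family of all its subsets. For $n\in\mathbb{Z}$ and $A\subseteq\mathbb{Z}$ put $n+A=\{n+a: a\in A\}$ (so $n+\varnothing=\varnothing$). A family $\mathscr{F}\subseteq\mathscr{P}(\omega)$ is $\omega$-closed if $F_1\cap(-n+F_2)\in\mathscr{F}$ for all $n\in\omega$ and $F_1,F_2\in\mathscr{F}$. For an $\omega$-closed family $\mathscr{F}$, the set $\mathbb{Z}\times\mathbb{Z}\times\mathscr{F}$ carries the associative operation $$(i_1,j_1,F_1)\cdot(i_2,j_2,F_2)=\begin{cases}(i_1-j_1+i_2,\;j_2,\;(j_1-i_2+F_1)\cap F_2), & j_1<i_2;\\ (i_1,\;j_2,\;F_1\cap F_2), & j_1=i_2;\\ (i_1,\;j_1-i_2+j_2,\;F_1\cap(i_2-j_1+F_2)), & j_1>i_2.\end{cases}$$ When $\varnothing\in\mathscr{F}$, the set $\boldsymbol{I}=\{(i,j,\varnothing): i,j\in\mathbb{Z}\}$ is an ideal and $\boldsymbol{B}_{\mathbb{Z}}^{\mathscr{F}}$ is defined as the Rees quotient $(\mathbb{Z}\times\mathbb{Z}\times\mathscr{F},\cdot)/\boldsymbol{I}$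 ($\boldsymbol{I}$ is collapsed to one element, the zero). A semigroup $S$ with zero $0$ is $0$-simple if $S\cdot S\neq\{0\}$ and $\{0\}$ is the only proper two-sided ideal of $S$.
   Formalization: The family F is additionally assumed to contain a nonempty set: for F = {∅} the semigroup is just {0}, hence not 0-simple, while the condition on nonempty sets holds vacuously, so the equivalence fails in that single case. *)

(* Defs.v *)
From HB Require Import structures.
From mathcomp Require Import all_boot all_order all_algebra.
From mathcomp Require Import boolp classical_sets.
From mathcomp Require Import zify.
Set Implicit Arguments.
Unset Strict Implicit.
Unset Printing Implicit Defensive.
Import Order.TTheory GRing.Theory Num.Theory.
Local Open Scope classical_set_scope.
Local Open Scope ring_scope.
Local Open Scope quotient_scope.

(* Subsets of omega are represented as sets of integers, so that the translates
   n + A and -n + A keep their literal meaning. *)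
Definition omega : set int := range Posz.

Definition shift (n : int) (A : set int) : set int := [set n + a | a in A].

Definition omega_closed (F : set (set int)) : Prop :=
  forall (n : int) (F1 F2 : set int), omega n -> F F1 -> F F2 ->
    F (F1 `&` shift (- n) F2).

Section Semigroups.
Variable S : semigroupType.
Local Open Scope group_scope.

(* Ideals are nonempty, as usual in semigroup theory: otherwise set0 would be
   a proper ideal of every nonempty semigroup. *)
Definition two_sided_ideal (I : set S) : Prop :=
  I !=set0 /\ forall s x : S, I x -> I (s * x) /\ I (x * s).

Definition is_zero (z : S) : Prop := forall x : S, z * x = z /\ x * z = z.

Definition zero_simple : Prop :=
  exists z : S, [/\ is_zero z,
    [set x * y | x in [set: S] & y in [set: S]] <> [set z] &
    forall I : set S, (two_sided_ideal I /\ I <> [set: S]) <-> I = [set z]].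

Definition rees_rel (I : set S) (x y : S) : bool :=
  (x == y) || (x \in I) && (y \in I).

Lemma rees_rel_equiv I : equiv_class_of (rees_rel I).
Proof.
split=> [x|x y|y x z]; rewrite /rees_rel ?eqxx //.
  by rewrite eq_sym andbC.
case/orP=> [/eqP->//|/andP[xI yI]] /orP[/eqP<-|/andP[_ zI]].
  by rewrite xI yI orbT.
by rewrite xI zI orbT.
Qed.

Canonical rees_equiv I := EquivRelPack (rees_rel_equiv I).

End Semigroups.

Definition rees (S : semigroupType) (I : set S) (hI : two_sided_ideal I) : Type :=
  {eq_quot rees_equiv I}.

Section Rees.
Variables (S : semigroupType) (I : set S) (hI : two_sided_ideal I).
Local Open Scope group_scope.

HB.instance Definition _ := Choice.on (rees hI).
HB.instance Definition _ := EqQuotient.on (rees hI).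

Definition rees_mul (x y : rees hI) : rees hI :=
  \pi_(rees hI) (repr x * repr y).

Lemma rees_piM_subproof (x y : S) :
  rees_mul (\pi_(rees hI) x) (\pi_(rees hI) y) = \pi_(rees hI) (x * y).
Proof.
have [_ idI] := hI.
have reprE a : rees_rel I (repr (\pi_(rees hI) a)) a.
  by have /eqmodP := reprK (\pi_(rees hI) a).
apply/eqmodP; rewrite /= /rees_rel.
have /orP[/eqP->|/andP[/set_mem xI' /set_mem xI]] := reprE x; last first.
  by rewrite !mem_set ?orbT //;
    first [exact: (idI _ _ xI).2 | exact: (idI _ _ xI').2].
have /orP[/eqP->|/andP[/set_mem yI' /set_mem yI]] := reprE y; first by rewrite eqxx.
by rewrite !mem_set ?orbT //;
  first [exact: (idI _ _ yI).1 | exact: (idI _ _ yI').1].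
Qed.

Lemma rees_mulA : associative rees_mul.
Proof.
elim/quotW=> x; elim/quotW=> y; elim/quotW=> z.
rewrite (rees_piM_subproof y z) (rees_piM_subproof x y).
by rewrite (rees_piM_subproof x (y * z)) (rees_piM_subproof (x * y) z) mulgA.
Qed.

HB.instance Definition _ := isSemigroup.Build (rees hI) rees_mulA.

Lemma rees_piM (x y : S) :
  \pi_(rees hI) x * \pi_(rees hI) y = \pi_(rees hI) (x * y).
Proof. exact: rees_piM_subproof. Qed.

Lemma rees_pi_eq (x y : S) :
  (\pi_(rees hI) x = \pi_(rees hI) y) <-> x = y \/ I x /\ I y.
Proof.
split=> [/eqmodP/orP[/eqP|/andP[/set_mem ? /set_mem ?]]|[->//|[xI yI]]].
- by left.
- by right.
by apply/eqmodP; rewrite /= /rees_rel !mem_set ?orbT.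
Qed.

Lemma rees_zero (x : S) : I x -> is_zero (\pi_(rees hI) x).
Proof.
move=> xI; elim/quotW=> y; rewrite !rees_piM.
have [? ?] := hI.2 y x xI.
by split; apply/rees_pi_eq; right.
Qed.

End Rees.

Definition triple_mul (x y : int * int * set int) : int * int * set int :=
  let: (i1, j1, F1) := x in
  let: (i2, j2, F2) := y in
  if j1 < i2 then (i1 - j1 + i2, j2, shift (j1 - i2) F1 `&` F2)
  else if j1 == i2 then (i1, j2, F1 `&` F2)
  else (i1, j1 - i2 + j2, F1 `&` shift (i2 - j1) F2).

Lemma shiftE n A x : shift n A x = A (x - n).
Proof.
apply/propext; split=> [[a Aa <-]|Ax]; first by rewrite addrC addKr.
by exists (x - n) => //; rewrite addrC subrK.
Qed.

Lemma triple_mulA : associative triple_mul.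
Proof.
move=> [[i1 j1] A] [[i2 j2] B] [[i3 j3] C]; rewrite /triple_mul.
case: (ltgtP j1 i2) => h1; case: (ltgtP j2 i3) => h2;
  repeat (case: ltgtP => ?; try lia).
all: congr (_, _, _); try lia.
all: apply/funext => x; apply/propext.
all: do 3 rewrite /setI /mkset /= ?shiftE.
all: split; [move=> [? [? ?]]|move=> [[? ?] ?]]; repeat split.
all: first [assumption | match goal with
  H : ?A ?u |- ?A ?v => suff <- : u = v by exact: H
  end; lia].
Qed.

(* Z x Z x F; the proof of omega-closedness is a phantom parameter, from which
   the semigroup structure is inferred. *)
Definition extended (F : set (set int)) (hF : omega_closed F) : Type :=
  (int * int * F)%type.

Section Extension.
Variables (F : set (set int)) (hF : omega_closed F).

HB.instance Definition _ := Choice.on (extended hF).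

Definition triple (x : extended hF) : int * int * set int := (x.1, \val x.2).

Lemma triple_inj : injective triple.
Proof. by move=> [p A] [q B] [-> /val_inj ->]. Qed.

Lemma triple_mul_mem (x y : extended hF) :
  (triple_mul (triple x) (triple y)).2 \in F.
Proof.
case: x y => [[i1 j1] [A /= /set_mem FA]] [[i2 j2] [B /= /set_mem FB]].
apply/mem_set; rewrite /triple_mul /=; case: ltgtP => h /=.
- rewrite setIC (_ : j1 - i2 = - (i2 - j1)); last by lia.
  by apply: hF => //; exists `|i2 - j1|%N => //; lia.
- rewrite (_ : i2 - j1 = - (j1 - i2)); last by lia.
  by apply: hF => //; exists `|j1 - i2|%N => //; lia.
have s0 : shift (- 0) B = B.
  by apply/funext => x; rewrite shiftE oppr0 subr0.
by rewrite -s0; apply: hF => //; exists 0%N.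
Qed.

Definition extended_mul (x y : extended hF) : extended hF :=
  ((triple_mul (triple x) (triple y)).1, exist (fun A => A \in F) _ (triple_mul_mem x y)).

Lemma triple_extended_mul x y :
  triple (extended_mul x y) = triple_mul (triple x) (triple y).
Proof. by rewrite [RHS]surjective_pairing. Qed.

Lemma extended_mulA : associative extended_mul.
Proof.
by move=> x y z; apply: triple_inj; rewrite !triple_extended_mul triple_mulA.
Qed.

HB.instance Definition _ := isSemigroup.Build (extended hF) extended_mulA.

Definition empty_ideal : set (extended hF) := [set x | \val x.2 = set0].

Lemma empty_idealP : F set0 -> two_sided_ideal empty_ideal.
Proof.
move=> F0; split.
  by exists ((0, 0), exist (fun A => A \in F) set0 (mem_set F0)).
move=> s x x0; have := triple_extended_mul.
rewrite /empty_ideal /= in x0 *.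
have shift0 n : shift n set0 = set0 by rewrite /shift image_set0.
case: s x x0 => [[i1 j1] [A FA]] [[i2 j2] [B FB]] /= -> _.
by split; case: ifP => _ /=; try (case: ifP => _ /=);
  rewrite ?shift0 ?setI0 ?set0I.
Qed.

End Extension.

Definition BZ (F : set (set int)) (hF : omega_closed F) (F0 : F set0) :
  semigroupType := rees (empty_idealP hF F0).

(* Main.v *)
Require Import Defs.
From mathcomp Require Import all_boot all_order all_algebra.
From mathcomp Require Import boolp classical_sets.
From mathcomp Require Import zify.
Import Order.TTheory GRing.Theory Num.Theory.
Local Open Scope classical_set_scope.
Local Open Scope ring_scope.

(** In a product of triples each set component is only ever translated by a
    nonpositive integer.  Hence the elements whose set lies in some [-k + A],
    [k >= 0], form an ideal, and 0-simplicity forces this ideal to be everything.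
    Conversely, if [H] is contained in [-k + G], then
    [(m, i + k, H) (i, j, G) (k + j, n, H) = (m, n, H)], so a nonzero element
    generates every other one. *)

Lemma omegaP (n : int) : omega n <-> 0 <= n.
Proof. by split=> [[m _ <-]//|n0]; exists `|n|%N => //; lia. Qed.

Lemma shift0 (A : set int) : shift 0 A = A.
Proof. by apply/funext => x; rewrite shiftE subr0. Qed.

(** The left set moves only when [j1 < i2], by the negative amount [j1 - i2]; otherwise [k = 0]
    serves. *)
Lemma triple_mul_subl (x y : int * int * set int) :
  exists2 k, 0 <= k & (triple_mul x y).2 `<=` shift (- k) x.2.
Proof.
case: x y => [[i1 j1] A] [[i2 j2] B]; rewrite /triple_mul.
case: ltgtP => h /=.
- by exists (i2 - j1); [lia|rewrite opprB; exact: subIsetl].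
- by exists 0 => //; rewrite oppr0 shift0; exact: subIsetl.
- by exists 0 => //; rewrite oppr0 shift0; exact: subIsetl.
Qed.

Lemma triple_mul_subr (x y : int * int * set int) :
  exists2 k, 0 <= k & (triple_mul x y).2 `<=` shift (- k) y.2.
Proof.
case: x y => [[i1 j1] A] [[i2 j2] B]; rewrite /triple_mul.
case: ltgtP => h /=.
- by exists 0 => //; rewrite oppr0 shift0; exact: subIsetr.
- by exists (j1 - i2); [lia|rewrite opprB; exact: subIsetr].
- by exists 0 => //; rewrite oppr0 shift0; exact: subIsetr.
Qed.

Lemma sub_shift_trans (A B C : set int) (k l : int) :
  A `<=` shift k B -> B `<=` shift l C -> A `<=` shift (k + l) C.
Proof.
move=> AB BC x /AB; rewrite !shiftE => /BC; rewrite shiftE.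
by rewrite opprD addrA.
Qed.

Lemma is_zero_unique (S : semigroupType) (z w : S) :
  is_zero z -> is_zero w -> z = w.
Proof. by move=> zz zw; rewrite -(zz w).1 (zw z).2. Qed.

Lemma zero_ideal (S : semigroupType) (z : S) :
  is_zero z -> two_sided_ideal [set z].
Proof. by move=> zz; split=> [|s x ->]; [exists z|rewrite (zz s).1 (zz s).2]. Qed.

Lemma ideal_zero (S : semigroupType) (z : S) (I : set S) :
  is_zero z -> two_sided_ideal I -> I z.
Proof. by move=> zz [[x Ix] idI]; rewrite -(zz x).1; exact: (idI z x Ix).1. Qed.

(** Simplicity concerns the quotient, whereas the ideals are built from triples. Projection is
    surjective, so every multiplier lifts and absorption passes to the image. *)
Lemma rees_ideal_image (S : semigroupType) (I : set S)
    (hI : two_sided_ideal I) (J : set S) :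
  two_sided_ideal J ->
  two_sided_ideal ((fun x => \pi_(rees hI) x)%qT @` J).
Proof.
move=> [[x Jx] idJ]; split; first by eexists; exists x.
move=> s y [{Jx} {}x Jx <-]; elim/quotW: s => s.
by rewrite !rees_piM; split; eexists; try reflexivity;
  [exact: (idJ s x Jx).1|exact: (idJ s x Jx).2].
Qed.

Section Extension.
Variables (F : set (set int)) (hF : omega_closed F).

Definition mk_extended (i j : int) (A : set int) (FA : F A) : extended hF :=
  ((i, j), exist (fun B => B \in F) A (mem_set FA)).

Lemma triple_mk_extended i j A (FA : F A) :
  triple (mk_extended i j A FA) = (i, j, A).
Proof. by []. Qed.

Lemma triple_mulg (x y : extended hF) :
  triple (x * y)%g = triple_mul (triple x) (triple y).
Proof. exact: triple_extended_mul. Qed.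

Definition subtranslate_ideal (A : set int) : set (extended hF) :=
  [set x | exists2 k, 0 <= k & (triple x).2 `<=` shift (- k) A].

(** Multiplying shifts the set by some further [- l] with [l >= 0], and nonpositive shifts compose
    to nonpositive shifts. *)
Lemma subtranslate_idealP (A : set int) :
  F A -> two_sided_ideal (subtranslate_ideal A).
Proof.
move=> FA; split.
  by exists (mk_extended 0 0 A FA), 0 => //; rewrite oppr0 shift0.
move=> s x [k k0 xA]; rewrite /subtranslate_ideal /mkset !triple_mulg; split.
  have [l l0 xl] := triple_mul_subr (triple s) (triple x).
  exists (l + k); first exact: addr_ge0.
  by rewrite opprD; exact: sub_shift_trans xl xA.
have [l l0 xl] := triple_mul_subl (triple x) (triple s).
exists (l + k); first exact: addr_ge0.
by rewrite opprD; exact: sub_shift_trans xl xA.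
Qed.

(** The index [i + k] makes the left product translate [G] by exactly [- k], so intersecting with
    [H] gives back [H]. The resulting second index [k + j] matches the last factor, which leaves [H]
    intersected with itself. *)
Lemma mk_extended_factor (i j m n k : int) (G H : set int)
    (FG : F G) (FH : F H) :
  0 <= k -> H `<=` shift (- k) G ->
  (mk_extended m (i + k) H FH * mk_extended i j G FG
    * mk_extended (k + j) n H FH)%g = mk_extended m n H FH.
Proof.
move=> k0 HG; apply: triple_inj; rewrite !triple_mulg !triple_mk_extended.
have -> : triple_mul (m, i + k, H) (i, j, G) = (m, k + j, H).
  (* Here [i + k < i] contradicts [0 <= k]; [i + k > i] is the translating case, and equality means
     [k = 0]. *)
  rewrite /triple_mul; case: ltgtP => h; first lia.
    congr (_, _, _); first lia.
    by rewrite (_ : i - (i + k) = - k); [exact: setIidl|lia].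
  have k00 : k = 0 by lia.
  move: HG; rewrite k00 oppr0 shift0 => HG.
  by rewrite add0r; congr (_, _, _); exact: setIidl.
by rewrite /triple_mul ltxx eqxx setIid.
Qed.

End Extension.

Theorem mainTheorem7 (F : set (set int))
    (Fomega : forall A, F A -> A `<=` omega)
    (Fclosed : omega_closed F) (F0 : F set0)
    (Fnontrivial : exists2 A, F A & A !=set0) :
  zero_simple (BZ Fclosed F0) <->
  (forall F1 F2 : set int, F F1 -> F F2 -> F1 !=set0 -> F2 !=set0 ->
     exists k1 k2 : int, [/\ omega k1, omega k2,
       F1 `<=` shift (- k1) F2 & F2 `<=` shift (- k2) F1]).
Proof.
pose pi (x : extended Fclosed) : BZ Fclosed F0 := (\pi_(BZ Fclosed F0) x)%qT.
pose mk := mk_extended F Fclosed.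
have piM x y : (pi x * pi y)%g = pi (x * y)%g by exact: rees_piM.
(* Only triples with empty set are collapsed, so a nonempty set determines its representative. *)
have pi_mk_inj x i j A (FA : F A) : A !=set0 -> pi (mk i j A FA) = pi x ->
    x = mk i j A FA.
  move=> [a Aa] /rees_pi_eq[//|[A0 _]].
  by have : set0 a by rewrite -A0.
pose o := pi (mk 0 0 set0 F0).
have o0 : is_zero o by exact: rees_zero.
have pi0 x : \val x.2 = set0 -> pi x = o.
  by move=> x0; apply/rees_pi_eq; right.
have pi_neq0 i j A (FA : F A) : A !=set0 -> pi (mk i j A FA) <> o.
  move=> Aneq0 /(pi_mk_inj _ _ _ _ _ Aneq0)/(congr1 (fun x => \val x.2)) /= A0.
  by case: Aneq0 => a; rewrite -A0.
split=> [[z [z0 _ simple]] | FF].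
  have sub F1 F2 : F F1 -> F F2 -> F1 !=set0 -> F2 !=set0 ->
      exists2 k, 0 <= k & F1 `<=` shift (- k) F2.
    move=> FF1 FF2 F1neq0 F2neq0.
    pose J := subtranslate_ideal F Fclosed F2.
    have idJ := subtranslate_idealP F Fclosed F2 FF2.
    (* The image of [J] contains the nonzero class of [(0, 0, F2)], so simplicity leaves only the
       whole quotient. *)
    have JT : pi @` J = [set: BZ Fclosed F0].
      apply: contrapT => JneqT.
      have Jz : pi @` J = [set z].
        by apply/simple; split=> //; exact: rees_ideal_image.
      have : (pi @` J) (pi (mk 0 0 F2 FF2)).
        by exists (mk 0 0 F2 FF2) => //; exists 0 => //; rewrite oppr0 shift0.
      by rewrite Jz (is_zero_unique _ _ _ z0 o0); exact: pi_neq0.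
    have : (pi @` J) (pi (mk 0 0 F1 FF1)) by rewrite JT.
    (* Since [F1] is nonempty, the preimage in [J] must be [(0, 0, F1)] itself, and its membership
       is the wanted inclusion. *)
    by case=> x Jx /esym/(pi_mk_inj _ _ _ _ _ F1neq0) xE; rewrite xE in Jx.
  move=> F1 F2 FF1 FF2 F1neq0 F2neq0.
  have [k1 k10 sub1] := sub F1 F2 FF1 FF2 F1neq0 F2neq0.
  have [k2 k20 sub2] := sub F2 F1 FF2 FF1 F2neq0 F1neq0.
  by exists k1, k2; split=> //; apply/omegaP.
have [A FA Aneq0] := Fnontrivial.
exists o; split=> //.
  (* The class of [(0, 0, A)] is a nonzero idempotent, so the set of products exceeds the zero. *)
  move=> SS; have : [set o] (pi (mk 0 0 A FA)); last exact: pi_neq0.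
  rewrite -SS; exists (pi (mk 0 0 A FA)) => //; exists (pi (mk 0 0 A FA)) => //.
  rewrite piM; congr pi; apply: triple_inj.
  by rewrite triple_mulg /triple_mul /= setIid.
move=> I; split=> [[idI IneqT]|->]; last first.
  split; first exact: zero_ideal.
  move=> oT; apply: (pi_neq0 0 0 A FA Aneq0).
  by rewrite -[_ = o]/([set o] _) oT.
have Io := ideal_zero _ _ _ o0 idI.
apply/seteqP; split=> [|_ ->//]; elim/quotW=> -[[i j] [G memG]].
move=> IG; have FG := set_mem memG.
have GE : ((i, j), exist _ G memG) = mk i j G FG by exact: triple_inj.
rewrite GE -/(pi _) in IG *.
have [G0|/set0P Gneq0] := eqVneq G set0; first exact: pi0.
(* A nonzero class of [(i, j, G)] in [I] would make [I] everything: an arbitrary [(m, n, H)] is now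
   reached from it. *)
case: IneqT; apply/seteqP; split=> //; elim/quotW=> -[[m n] [H memH]] _.
have FH := set_mem memH.
have -> : ((m, n), exist _ H memH) = mk m n H FH by exact: triple_inj.
rewrite -/(pi _).
have [H0|/set0P Hneq0] := eqVneq H set0; first by rewrite pi0.
have [k [_ [/omegaP k0 _ HG _]]] := FF H G FH FG Hneq0 Gneq0.
(* The class of [(m, n, H)] becomes a product whose middle factor is the class of [(i, j, G)], so it
   is absorbed by [I]. *)
rewrite /mk -(mk_extended_factor F Fclosed i j m n k G H FG FH k0 HG) -!piM.
by apply: (idI.2 _ _ _).2; exact: (idI.2 _ _ IG).1.
Qed.
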